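(* Let $m,n$ and $\ell$ be positive integers. For the complete bipartite graph $K_{m,n}$, the number $\tau_\ell(K_{m,n})$ of $\ell$-congruent spanning trees of $K_{m,n}$ is $$\tau_{\ell}(K_{m,n})= \frac{1}{\ell^{m+n}}\left[\sum_{\substack{k_0+k_1+\cdots+k_{\ell-1}=m\\ k_0,\ldots,k_{\ell-1}\ge 0}}\frac{m!}{k_0!\,k_1!\cdots k_{\ell-1}!}\left(\sum_{p=0}^{\ell-1}k_p\, e^{\frac{2\pi\mathrm{i}}{\ell}p}\right)^{n-1}\right]\times\left[\sum_{\substack{s_0+s_1+\cdots+s_{\ell-1}=n\\ s_0,\ldots,s_{\ell-1}\ge 0}}\frac{n!}{s_0!\,s_1!\cdots s_{\ell-1}!}\left(\sum_{q=0}^{\ell-1}s_q\, e^{\frac{2\pi\mathrm{i}}{\ell}q}\right)^{m-1}\right],$$ where the sums are over all $\ell$-tuples of nonnegative integers $(k_0,\ldots,k_{\ell-1})$ with sum $m$ and $(s_0,\ldots,s_{\ell-1})$ with sum $n$, respectively.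
   Context: For a positive integer $\ell$, an $\ell$-congruent tree is a nontrivial tree $T$ (at least two vertices) such that the degrees of all vertices of $T$ are congruent modulo $\ell$; equivalently, $d_T(v)\equiv 1\pmod{\ell}$ for every $v\in V(T)$, where $d_T(v)$ is the degree of $v$ in $T$. An $\ell$-congruent spanning tree of a graph $G$ is a spanning tree of $G$ that is an $\ell$-congruent tree. $\tau_\ell(G)$ denotes the number of $\ell$-congruent spanning trees of $G$, where the vertices of $G$ are labelled (spanning trees are counted as distinct subgraphs, not up to isomorphism). $K_{m,n}$ is the complete bipartite graph with parts of sizes $m$ and $n$, $\mathrm{i}$ is the imaginary unit, and the convention $0^0=1$ is used. *)

(* Defs.v *)
From HB Require Import structures.
From mathcomp Require Import all_boot all_order all_algebra.
From mathcomp Require Import boolp reals sequences exp trigo.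
From mathcomp Require Import complex.

Set Implicit Arguments.
Unset Strict Implicit.
Unset Printing Implicit Defensive.

Import Order.TTheory GRing.Theory Num.Theory.

Local Open Scope ring_scope.
Local Open Scope complex_scope.

(* A finite simple graph on the labelled vertex set V is its set of edges,
   each edge being a set of two vertices. Since all graphs on V share the same
   vertex set, a spanning subgraph of G is a T with edges T \subset edges G. *)
Record sgraph (V : finType) := SGraph {
  edges : {set {set V}};
  edges_card2 : [forall e in edges, #|e| == 2%N]
}.

HB.instance Definition _ (V : finType) := [isSub for @edges V].
HB.instance Definition _ (V : finType) := [Finite of sgraph V by <:].

Definition adj (V : finType) (G : sgraph V) : rel V :=
  fun x y => [set x; y] \in edges G.

Definition degree (V : finType) (G : sgraph V) (v : V) : nat :=
  #|[set e in edges G | v \in e]|.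

Definition connected (V : finType) (G : sgraph V) : Prop :=
  forall x y : V, connect (adj G) x y.

(* The size condition excludes the empty cycle and the back-and-forth walk
   along a single edge, both of which satisfy ucycle. *)
Definition acyclic (V : finType) (G : sgraph V) : Prop :=
  forall c : seq V, (2 < size c)%N -> ~ ucycle (adj G) c.

Definition is_tree (V : finType) (T : sgraph V) : Prop :=
  [/\ (0 < #|V|)%N, connected T & acyclic T].

Definition is_congruent_tree (l : nat) (V : finType) (T : sgraph V) : Prop :=
  [/\ is_tree T, (1 < #|V|)%N &
      forall u v : V, degree T u = degree T v %[mod l]].

Definition is_congruent_spanning_tree (l : nat) (V : finType)
    (G T : sgraph V) : Prop :=
  edges T \subset edges G /\ is_congruent_tree l T.

Definition tau (l : nat) (V : finType) (G : sgraph V) : nat :=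
  #|[set T : sgraph V | `[< is_congruent_spanning_tree l G T >]]|.

Definition Kmn_edges (m n : nat) : {set {set 'I_m + 'I_n}} :=
  [set [set inl i; inr j] | i : 'I_m, j : 'I_n].

Lemma Kmn_edges_card2 (m n : nat) :
  [forall e in Kmn_edges m n, #|e| == 2%N].
Proof.
by apply/forall_inP => e /imset2P[i j _ _ ->]; rewrite cards2.
Qed.

Definition Kmn (m n : nat) : sgraph ('I_m + 'I_n)%type :=
  SGraph (Kmn_edges_card2 m n).

Definition cexp (R : realType) (z : R[i]) : R[i] :=
  (expR (complex.Re z))%:C *
  (cos (complex.Im z) +i* sin (complex.Im z)).

(* The l-tuples of natural numbers with sum m; the entries of such a tuple are
   at most m, so nothing is lost by taking them in 'I_m.+1. *)
Definition weak_compositions (l m : nat) : {set {ffun 'I_l -> 'I_m.+1}} :=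
  [set k : {ffun 'I_l -> 'I_m.+1} | (\sum_(p < l) k p)%N == m].

(* Main.v *)
Require Import Defs.
From mathcomp Require Import all_boot all_order all_fingroup all_algebra.
From mathcomp Require Import boolp reals sequences exp trigo.
From mathcomp Require Import complex lra.

Set Implicit Arguments.
Unset Strict Implicit.
Unset Printing Implicit Defensive.

Import Order.TTheory GRing.Theory Num.Theory.

Local Open Scope ring_scope.
Local Open Scope complex_scope.

(** The degrees of the trees in K_(m,n) have a product generating function:
    with a weight x_i on each left vertex and y_j on each right vertex,
      sum over the spanning trees T of prod_v z_v^(deg_T v)
        = (prod_v z_v) * (sum_i x_i)^(n-1) * (sum_j y_j)^(m-1)
    ([degree_enumerator_Kmn]). The congruence condition on the degrees is then
    extracted by a root of unity filter. A tree with at least two vertices has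
    a leaf, so its degrees are all congruent modulo l exactly when they are all
    1 modulo l. If every z_v runs over the l-th roots of unity, the sum of
    z_v^(deg v + l - 1) is l when l divides deg v - 1 and 0 otherwise; hence
    summing the identity above, multiplied by prod_v z_v^(l-1), over all
    choices of roots gives l^(m+n) * tau on the left. On the right the factor
    prod_v z_v^l is 1, and the sum splits into one sum over the colourings of
    the left side and one over those of the right side
    ([tau_Kmn_root_of_unity]). Each depends on a colouring only through the
    sizes of its fibres, and the number of colourings with given fibre sizes is
    a multinomial coefficient ([sum_colourings]).

    The generating function comes from a matrix-tree theorem with weights on
    the vertices ([weighted_matrix_tree]). Root all trees at a fixed vertex r:
    a tree is the same thing as a parent function f whose iterates lead from
    every vertex to r, and the degree of v is the number of its children, plus
    one if v is not r. Expanding each row of the reduced Laplacian as the sum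
    of its contributions from the possible parents writes the determinant as a
    sum over all functions f of a weight times the determinant attached to f
    alone, and the latter is 1 if f leads to r and 0 otherwise. For K_(m,n)
    elementary row and column operations make the reduced Laplacian
    triangular ([det_bordered]). *)

(** * Trees as parent functions *)

Section Arborescences.

Variables (V : finType) (r : V).
Implicit Types (f g : {ffun V -> V}) (T G : sgraph V).

Lemma eq_set2 (x y u w : V) :
  [set x; y] = [set u; w] -> (x = u /\ y = w) \/ (x = w /\ y = u).
Proof.
move=> E; have: x \in [set u; w] by rewrite -E set21.
have: y \in [set u; w] by rewrite -E set22.
have: u \in [set x; y] by rewrite E set21.
have: w \in [set x; y] by rewrite E set22.
rewrite !inE => /orP[]/eqP-> /orP[]/eqP-> /orP[]/eqP? /orP[]/eqP ?; subst; auto.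
Qed.

Lemma adj_sym G : symmetric (adj G).
Proof. by move=> x y; rewrite /adj setUC. Qed.

Lemma adj_irrefl G x : adj G x x = false.
Proof.
apply/negP => /(forall_inP (edges_card2 G)).
by rewrite setUid cards1.
Qed.

Lemma edge_adj G e : e \in edges G -> exists x y, e = [set x; y] /\ adj G x y.
Proof.
move=> eG; have /cards2P[x [y [_ E]]] := forall_inP (edges_card2 G) _ eG.
by exists x, y; rewrite /adj -E.
Qed.

(** Trees rooted at [r], encoded by their parent functions; the root is made its
    own parent so that [f] is total. *)
Definition arborescence f : bool :=
  (f r == r) && [forall v, fconnect f v r].

(** Only the root may be left on the way to itself, so the first step away from
    [v] is forced. *)
Lemma fconnect_parent (f : V -> V) v :
  v != r -> fconnect f v r = fconnect f (f v) r.
Proof.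
move=> vr; apply/idP/idP => [/connectP[[|x p]] /=|].
- by move=> _ rv; rewrite rv eqxx in vr.
- by case/andP=> /eqP-> pp ->; apply/connectP; exists p.
exact: connect_trans (fconnect1 f v).
Qed.

(** The rank is the distance to the root. A strictly decreasing rank is the
    form in which the absence of cycles is used everywhere below. *)
Lemma arborescence_rank f : arborescence f ->
  f r = r /\ exists d : V -> nat, forall v, v != r -> (d (f v) < d v)%N.
Proof.
case/andP=> /eqP fr /forallP fc; split=> //.
have reach v : exists k, iter k f v == r.
  by exists (findex f v r); rewrite iter_findex.
exists (fun v => ex_minn (reach v)) => v vr.
case: (ex_minnP (reach v)) => -[|k]; first by rewrite /= (negPf vr).
move=> Hk _; case: ex_minnP => j _ jmin.
by rewrite ltnS jmin // -iterSr.
Qed.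

Lemma rank_arborescence f (d : V -> nat) : f r = r ->
  (forall v, v != r -> (d (f v) < d v)%N) -> arborescence f.
Proof.
move=> fr dec; rewrite /arborescence fr eqxx; apply/forallP => v.
have [k] := ubnP (d v); elim: k v => // k IH v dv.
have [->|vr] := eqVneq v r; first exact: connect0.
apply: connect_trans (fconnect1 f v) (IH _ _).
exact: leq_trans (dec _ vr) _.
Qed.

Lemma parent_edges_card2 f :
  [forall e in [set [set v; f v] | v : V & f v != v], #|e| == 2%N].
Proof.
apply/forall_inP => e /imsetP[v]; rewrite inE => fv ->.
by rewrite cards2 (eq_sym v) fv.
Qed.

Definition parent_graph f : sgraph V := SGraph (parent_edges_card2 f).

Lemma adj_parent_graph f x y :
  adj (parent_graph f) x y = (x != y) && ((f x == y) || (f y == x)).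
Proof.
apply/imsetP/andP => [[v]|[xy]].
  rewrite inE => fv /eq_set2[[-> ->]|[-> ->]].
    by rewrite eqxx eq_sym.
  by rewrite eqxx orbT.
case/orP=> /eqP E; [exists x|exists y]; rewrite ?inE E // 1?eq_sym //.
by rewrite setUC.
Qed.

Lemma parent_neq f v : arborescence f -> (f v != v) = (v != r).
Proof.
case/arborescence_rank => fr [d dec]; apply/idP/idP => [|/dec].
  by apply: contra => /eqP->; rewrite fr.
by apply: contraTneq => ->; rewrite ltnn.
Qed.

Lemma parent_graph_connect_root f v :
  arborescence f -> connect (adj (parent_graph f)) v r.
Proof.
move=> fA; have [_ /forallP/(_ v)] := andP fA.
apply: connect_sub => x y /eqP <-.
have [->|xy] := eqVneq (f x) x; first exact: connect0.
by apply: connect1; rewrite adj_parent_graph eq_sym xy eqxx.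
Qed.

Lemma parent_graph_connected f : arborescence f -> connected (parent_graph f).
Proof.
move=> fA x y; apply: connect_trans (parent_graph_connect_root x fA) _.
rewrite (sym_connect_sym (adj_sym _)).
exact: parent_graph_connect_root.
Qed.

(** On a cycle of the graph, a vertex of maximal rank can only be joined to its
    parent; but it has two distinct neighbours on the cycle. *)
Lemma parent_graph_acyclic f : arborescence f -> acyclic (parent_graph f).
Proof.
case/arborescence_rank => fr [d dec] c.
case: c => // x0 c0; set c := x0 :: c0 => sz cyc.
have [v vc vmax] : exists2 v, v \in c & {in c, forall u, d u <= d v}%N.
  have x0c : x0 \in c by rewrite mem_head.
  by case: (arg_maxnP d x0c) => v vc vmax; exists v.
have up u : u \in c -> adj (parent_graph f) v u -> f v = u.
  move=> uc; rewrite adj_parent_graph => /andP[vu /orP[/eqP//|/eqP fu]].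
  have ur : u != r by apply: contra vu => /eqP ur; rewrite -fu ur fr.
  by have := leq_trans (dec _ ur) (vmax _ uc); rewrite fu ltnn.
have [i c' Ec] := rot_to vc.
have memc : c =i v :: c' by move=> z; rewrite -Ec mem_rot.
move: cyc; rewrite -(rot_ucycle i) Ec.
have: (2 < size (v :: c'))%N by rewrite -Ec size_rot.
case: c' {Ec} memc => [|x [|y c']] // memc _ /andP[/= /and3P[vx _]].
rewrite rcons_path => /andP[_ lv] /and3P[_ xyc _].
have lc : last y c' \in c by rewrite memc 2!in_cons mem_last !orbT.
have xc : x \in c by rewrite memc !inE eqxx orbT.
rewrite adj_sym in lv; move: xyc.
by rewrite -(up _ xc vx) (up _ lc lv) /= mem_last.
Qed.

Lemma parent_graph_tree f : arborescence f -> is_tree (parent_graph f).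
Proof.
move=> fA; split; [|exact: parent_graph_connected|exact: parent_graph_acyclic].
by apply/card_gt0P; exists r.
Qed.

(** Send each vertex to a neighbour that is closer to the root. *)
Lemma bfs_parent T : connected T ->
  exists2 f, arborescence f & forall v, v != r -> adj T v (f v).
Proof.
move=> cT.
pose walk v n := [exists p : n.-tuple V, path (adj T) v p && (last v p == r)].
have reach v : exists n, walk v n.
  have /connectP[p pp lp] := cT v r; exists (size p); apply/existsP.
  by exists (in_tuple p); rewrite pp -lp eqxx.
pose d v := ex_minn (reach v).
have next v : v != r -> exists x, adj T v x && (d x < d v)%N.
  move=> vr; rewrite {2}/d; case: ex_minnP => -[|n] /existsP[p].
    by rewrite tuple0 /= (negPf vr).
  case/tupleP: p => x p /= /andP[/andP[vx xp] lp] _.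
  exists x; rewrite vx /d; case: ex_minnP => k _ kmin.
  by rewrite ltnS kmin //; apply/existsP; exists p; rewrite xp lp.
pose f := [ffun v => odflt r [pick x | adj T v x && (d x < d v)%N && (v != r)]].
have fP v : v != r -> adj T v (f v) && (d (f v) < d v)%N.
  move=> vr; rewrite ffunE; case: pickP => [x /andP[]//|no].
  by have [x vx] := next _ vr; have := no x; rewrite vx vr.
exists f => [|v /fP/andP[]//]; apply: (@rank_arborescence _ d).
  by rewrite ffunE; case: pickP => // x; rewrite eqxx andbF.
by move=> v /fP/andP[].
Qed.

(** An edge of [T] outside [G] would close up a simple path of [G] between its
    ends to a cycle of [T]. *)
Lemma connected_subgraph_tree G T : connected G -> acyclic T ->
  edges G \subset edges T -> G = T.
Proof.
move=> cG aT sub; apply/val_inj/eqP; rewrite eqEsubset sub /=.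
apply/subsetP => e eT; have [x [y [Ee xy]]] := edge_adj eT.
rewrite Ee; apply: contraT => nG.
have /connectP[p0 pp0 Ey] := cG y x.
move: Ey; case/shortenP: pp0 => p pp up _ Ex.
have sG : subrel (adj G) (adj T) by move=> u w; apply: (subsetP sub).
case: p pp up Ex => [|z [|z' p]] pp up Ex.
- by rewrite Ex adj_irrefl in xy.
- by move: pp nG; rewrite Ex /= andbT adj_sym /adj => ->.
case: (aT (y :: z :: z' :: p)) => //; apply/andP; split=> //.
rewrite Ex /= in xy.
by rewrite (cycle_path y) /= xy; exact: (sub_path sG pp).
Qed.

(** The breadth-first parents span a connected subgraph of the tree, which is
    therefore all of it. *)
Lemma parent_graph_surj T : is_tree T ->
  exists2 f, arborescence f & parent_graph f = T.
Proof.
case=> _ cT aT; have [f fA fT] := bfs_parent cT.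
exists f => //; apply: connected_subgraph_tree => //.
  exact: parent_graph_connected.
apply/subsetP => e /imsetP[v]; rewrite inE parent_neq // => vr ->.
exact: fT.
Qed.

(** If two parent functions first differed, in order of rank, at [v], the edge
    from [v] to [f v] would have to be the edge from [f v] to [g (f v)]; since
    [f] and [g] agree at [f v], this makes [v] and [f v] parents of each
    other. *)
Lemma parent_graph_inj : {in arborescence &, injective parent_graph}.
Proof.
move=> f g fA gA Efg; apply/ffunP => v.
have [fr [d dec]] := arborescence_rank fA.
have [gr _] := arborescence_rank gA.
have [k] := ubnP (d v); elim: k v => // k IH v dv.
have [->|vr] := eqVneq v r; first by rewrite fr gr.
have: adj (parent_graph g) v (f v).
  by rewrite -Efg adj_parent_graph eqxx eq_sym parent_neq ?vr.
rewrite adj_parent_graph => /andP[vfv /orP[/eqP//|/eqP gfv]].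
have ffv : f (f v) = v by rewrite -[RHS]gfv IH // (leq_trans (dec _ vr)).
have fvr : f v != r by apply: contra vr => /eqP fvr; rewrite -ffv fvr fr.
by have := ltn_trans (dec _ fvr) (dec _ vr); rewrite ffv ltnn.
Qed.

(** The edges at [v] lead to its parent and to its children. *)
Lemma degree_parent_graph f v : arborescence f ->
  degree (parent_graph f) v =
    ((v != r) + #|[set u | (u != r) && (f u == v)]|)%N.
Proof.
move=> fA; have [fr [d dec]] := arborescence_rank fA.
pose h u := [set u; f u].
have hinj : {in [pred u | u != r] &, injective h}.
  move=> u w; rewrite !inE => ur wr /eq_set2[[]//|[Eu Ew]].
  have := dec _ wr; have := dec _ ur; rewrite Ew -Eu => /ltn_trans lt /lt.
  by rewrite ltnn.
rewrite /degree.
have -> : [set e in edges (parent_graph f) | v \in e]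
   = h @: [set u | (u != r) && ((u == v) || (f u == v))].
  apply/setP => e; rewrite inE; apply/andP/imsetP.
    case=> /imsetP[u]; rewrite inE parent_neq // => ur -> vu.
    by exists u => //; move: vu; rewrite !inE ur !(eq_sym v).
  case=> u; rewrite inE => /andP[ur uv] ->; split; last first.
    by rewrite !inE !(eq_sym v).
  by apply/imsetP; exists u; rewrite // inE parent_neq.
rewrite card_in_imset => [|u w]; last first.
  by rewrite !inE => /andP[ur _] /andP[wr _]; apply: hinj.
have -> : [set u | (u != r) && ((u == v) || (f u == v))] =
   [set u | (u != r) && (u == v)] :|: [set u | (u != r) && (f u == v)].
  by apply/setP => u; rewrite !inE andb_orr.
rewrite cardsU -[RHS]subn0; congr (_ + _ - _)%N.
  have [->|vr] := eqVneq v r.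
    apply/eqP; rewrite cards_eq0 -subset0.
    by apply/subsetP => u; rewrite !inE andNb.
  rewrite /= -(cards1 v); apply: eq_card => u; rewrite !inE.
  by case: (u =P v) => [->|_]; rewrite ?vr ?andbF.
apply/eqP; rewrite cards_eq0 -subset0; apply/subsetP => u; rewrite !inE.
move=> /andP[/andP[ur /eqP Eu] /andP[_ fu]].
by rewrite Eu in fu ur; have := parent_neq v fA; rewrite fu ur.
Qed.

(** A non-root vertex farthest from the root has no children. *)
Lemma tree_leaf T : is_tree T -> (1 < #|V|)%N -> exists v, degree T v = 1%N.
Proof.
move=> /parent_graph_surj[f fA <-] V2.
have [fr [d dec]] := arborescence_rank fA.
have [w wr] : exists w, w != r.
  have: (0 < #|[set~ r]|)%N by rewrite cardsC1 -subn1 subn_gt0.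
  by case/card_gt0P => w; rewrite !inE; exists w.
have [v vr vmax] := @arg_maxnP _ w (fun v => v != r) d wr.
have noch : [set u | (u != r) && (f u == v)] = set0.
  apply/setP => u; rewrite !inE; apply/negP => /andP[ur /eqP fu].
  by have := leq_trans (dec _ ur) (vmax u ur); rewrite fu ltnn.
by exists v; rewrite degree_parent_graph // noch cards0 addn0 vr.
Qed.

End Arborescences.

(** * The determinant of a functional Laplacian *)

Section DirectedMatrixTree.

Variables (R : fieldType) (V : finType) (r : V) (N : nat).
Variables (vtx : 'I_N -> V) (idx : V -> 'I_N).
Hypotheses (vtxK : cancel vtx idx) (idxK : cancel idx vtx).

(** Multilinearity of the determinant in its rows, where each row is a sum over
    the same index set [V]. *)
Lemma det_row_expansion (w : V -> V -> R) (c : V -> V -> V -> R) :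
  \det (\matrix_(i, j) \sum_k w (vtx i) k * c (vtx i) k (vtx j)) =
  \sum_(f : {ffun V -> V}) (\prod_v w v (f v)) *
     \det (\matrix_(i, j) c (vtx i) (f (vtx i)) (vtx j)).
Proof.
have reV (F : 'I_N -> R) : \prod_i F i = \prod_v F (idx v).
  by rewrite (reindex idx) //; exists vtx => ? _.
rewrite /determinant.
under [RHS]eq_bigr do rewrite mulr_sumr.
rewrite [RHS]exchange_big; apply: eq_bigr => s _ /=.
under [RHS]eq_bigr do rewrite mulrCA.
rewrite -mulr_sumr; congr (_ * _); rewrite reV.
under eq_bigr do rewrite mxE idxK.
rewrite bigA_distr_bigA; apply: eq_bigr => f _.
rewrite big_split reV; congr (_ * _).
by apply: eq_bigr => v _; rewrite mxE idxK.
Qed.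

(** The contribution of the parent [k] to row [i] of the Laplacian, with the row
    of the root replaced by a unit vector, so that the determinant is that of
    the Laplacian with the row and column of the root deleted. *)
Definition laplacian_coef (i k j : V) : R :=
  if i == r then (j == r)%:R else (i == j)%:R - (k == j)%:R.

(** If some vertex never reaches [r], the indicator of all such vertices is a
    nonzero kernel vector. Otherwise only the identity contributes to the
    Leibniz formula: a contributing permutation sends each vertex to itself or
    to its parent, so a moved vertex would lie on a cycle of parents. *)
Lemma det_functional_laplacian (f : {ffun V -> V}) : f r = r ->
  \det (\matrix_(i, j) laplacian_coef (vtx i) (f (vtx i)) (vtx j)) =
  (arborescence r f)%:R.
Proof.
move=> fr; have [fA|] := boolP (arborescence r f); last first.
  rewrite /arborescence fr eqxx /= => /forallPn[v0 v0r].
  apply/eqP; rewrite -det_tr; apply/det0P.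
  exists (\row_i (~~ fconnect f (vtx i) r)%:R).
    apply/eqP => /rowP/(_ (idx v0)); rewrite !mxE idxK v0r => /eqP.
    by rewrite oner_eq0.
  apply/rowP => i; rewrite !mxE /=.
  pose F v : R := (~~ fconnect f v r)%:R * laplacian_coef (vtx i) (f (vtx i)) v.
  rewrite (eq_bigr (fun j => F (vtx j))) => [|j _]; last by rewrite !mxE.
  have -> : \sum_j F (vtx j) = \sum_v F v.
    by rewrite [RHS](reindex vtx) //; exists idx => ? _.
  rewrite {}/F /laplacian_coef; have [_|ir] := eqVneq (vtx i) r.
    rewrite (bigD1 r) //= connect0 mul0r add0r big1 // => v /negPf->.
    by rewrite mulr0.
  under eq_bigr do rewrite mulrBr.
  rewrite sumrB (bigD1 (vtx i)) //= eqxx big1 => [|v /negPf]; last first.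
    by rewrite eq_sym => ->; rewrite mulr0.
  rewrite (bigD1 (f (vtx i))) //= eqxx big1 => [|v /negPf]; last first.
    by rewrite eq_sym => ->; rewrite mulr0.
  by rewrite !mulr1 !addr0 (fconnect_parent _ ir) subrr.
have [_ [d dec]] := arborescence_rank fA.
rewrite /determinant (bigD1 1%g) //= [X in _ + X]big1 ?addr0 => [|s s1].
  rewrite odd_perm1 mul1r big1 // => i _; rewrite !mxE perm1 /laplacian_coef.
  have [ir|ir] := eqVneq (vtx i) r; first by [].
  by rewrite eqxx (negPf (_ : f _ != _)) ?subr0 // (parent_neq _ fA).
apply/eqP; rewrite mulf_eq0 signr_eq0 /=; apply: contraNT s1 => /prodf_neq0 nz.
apply/eqP/permP => i; rewrite perm1.
(* By induction on the rank: if s sends v to its parent, which s already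
   fixes, then v is its own parent by injectivity. *)
suff: forall v, vtx (s (idx v)) = v.
  by move=> /(_ (vtx i)); rewrite vtxK => /(can_inj vtxK).
move=> v; have [k] := ubnP (d v); elim: k v {i} => // k IH v dv.
have := nz (idx v) isT; rewrite !mxE idxK /laplacian_coef.
have [->|vr] := eqVneq v r; first by case: (vtx _ =P r); rewrite ?eqxx.
case: (v =P vtx _) => // vs; case: (f v =P _) => [fs _|]; last first.
  by rewrite subrr eqxx.
have := IH (f v) (leq_trans (dec _ vr) dv); rewrite [RHS]fs => /(can_inj vtxK).
by move=> /perm_inj/(can_inj idxK) fv; rewrite -fs fv.
Qed.

End DirectedMatrixTree.

(** * A matrix-tree theorem with vertex weights *)

Section TreeEnumerator.

Variables (R : fieldType) (V : finType) (r : V) (N : nat).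
Variables (vtx : 'I_N -> V) (idx : V -> 'I_N).
Hypotheses (vtxK : cancel vtx idx) (idxK : cancel idx vtx).
Variables (G : sgraph V) (z : V -> R).

(** Allowing the root no parent but itself restricts the expansion of the
    determinant to the functions that fix it. *)
Definition parent_weight (v k : V) : R :=
  if v == r then (k == r)%:R else (adj G v k)%:R * z k.

Definition reduced_laplacian (v u : V) : R :=
  if v == r then (u == r)%:R
  else (v == u)%:R * (\sum_k (adj G v k)%:R * z k) - (adj G v u)%:R * z u.

Lemma reduced_laplacianE v u :
  reduced_laplacian v u = \sum_k parent_weight v k * laplacian_coef R r v k u.
Proof.
rewrite /reduced_laplacian /parent_weight /laplacian_coef.
have [_|vr] := eqVneq v r.
  by rewrite -mulr_suml (bigD1 r) //= eqxx big1 ?addr0 ?mul1r // => k /negPf->.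
under [RHS]eq_bigr do rewrite mulrBr.
rewrite sumrB -mulr_suml [LHS]/= mulrC; congr (_ - _).
by rewrite (bigD1 u) //= eqxx mulr1 big1 ?addr0 // => k /negPf->; rewrite mulr0.
Qed.

Lemma det_reduced_laplacian :
  \det (\matrix_(i, j) reduced_laplacian (vtx i) (vtx j)) =
  \sum_(f | arborescence r f) \prod_v parent_weight v (f v).
Proof.
transitivity (\det (\matrix_(i, j)
    \sum_k parent_weight (vtx i) k * laplacian_coef R r (vtx i) k (vtx j))).
  by congr (\det _); apply/matrixP => i j; rewrite !mxE reduced_laplacianE.
rewrite (det_row_expansion vtxK idxK) [RHS]big_mkcond; apply: eq_bigr => f _.
have [fr|fr] := eqVneq (f r) r.
  rewrite (det_functional_laplacian R vtxK idxK fr).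
  by case: ifP; rewrite ?mulr1 ?mulr0.
rewrite /arborescence (negPf fr) (bigD1 r) //=.
rewrite {1}/parent_weight eqxx (negPf fr).
by rewrite !mul0r.
Qed.

(** Every non-root vertex counts once for the edge to its parent, and every
    vertex counts once for each of its children. *)
Lemma prod_degree_parent_graph (f : {ffun V -> V}) : arborescence r f ->
  \prod_v z v ^+ degree (parent_graph f) v =
  (\prod_(v | v != r) z v) * \prod_(v | v != r) z (f v).
Proof.
move=> fA; under eq_bigr do rewrite (degree_parent_graph _ fA) exprD.
rewrite big_split; congr (_ * _).
  rewrite [RHS]big_mkcond; apply: eq_bigr => v _.
  by case: ifP; rewrite ?expr1 ?expr0.
rewrite [RHS](partition_big f predT) //=; apply: eq_bigr => v _.
rewrite (eq_bigr (fun=> z v)) => [|u /andP[_ /eqP->//]].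
by rewrite prodr_const; congr (_ ^+ _); apply: eq_card => u; rewrite !inE.
Qed.

Lemma prod_parent_weight (f : {ffun V -> V}) : arborescence r f ->
  \prod_v parent_weight v (f v) =
  (edges (parent_graph f) \subset edges G)%:R * \prod_(v | v != r) z (f v).
Proof.
move=> fA; have [/eqP fr _] := andP fA.
rewrite (bigD1 r) //= {1}/parent_weight eqxx fr eqxx mul1r.
rewrite (eq_bigr (fun v => (adj G v (f v))%:R * z (f v))); last first.
  by move=> v /negPf vr; rewrite /parent_weight vr.
rewrite big_split; congr (_ * _).
have [/subsetP sub|/subsetPn[e /imsetP[v]]] := boolP (_ \subset _).
  rewrite big1 // => v vr; rewrite (_ : adj _ _ _) //; apply: sub.
  by apply/imsetP; exists v; rewrite // inE (parent_neq _ fA).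
rewrite inE (parent_neq _ fA) => vr -> /negPf nG.
by rewrite (bigD1 v) //= /adj nG mul0r.
Qed.

(** The factor over the non-root vertices accounts for the edge that joins each
    of them to its parent; the determinant only sees the children. *)
Theorem weighted_matrix_tree :
  \sum_(T : sgraph V | `[< is_tree T >] && (edges T \subset edges G))
     \prod_v z v ^+ degree T v =
  (\prod_(v | v != r) z v) *
  \det (\matrix_(i, j) reduced_laplacian (vtx i) (vtx j)).
Proof.
rewrite det_reduced_laplacian mulr_sumr.
pose A := [set f : {ffun V -> V} | arborescence r f].
transitivity (\sum_(T in (@parent_graph V) @: A)
   (edges T \subset edges G)%:R * \prod_v z v ^+ degree T v).
  rewrite big_mkcondr /= big_mkcond [RHS]big_mkcond; apply: eq_bigr => T _.
  have -> : (T \in (@parent_graph V) @: A) = `[< is_tree T >].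
    apply/imsetP/asboolP => [[f]|/(parent_graph_surj r)[f fA <-]].
      by rewrite inE => fA ->; apply: parent_graph_tree fA.
    by exists f; rewrite ?inE.
  by case: ifP => // _; case: ifP; rewrite ?mul1r ?mul0r.
rewrite big_imset => [|f g]; last by rewrite !inE; apply: parent_graph_inj.
apply: eq_big => [f|f]; rewrite inE // => fA.
by rewrite prod_degree_parent_graph // prod_parent_weight // mulrCA.
Qed.

End TreeEnumerator.

(** * Elimination in a bordered matrix *)

Section CompleteBipartiteDeterminant.

Variable R : fieldType.

(** The reduced Laplacian of a complete bipartite graph, with one vertex of the
    right side put last. Subtracting the last row from the first [q] ones clears
    their entries against [a]; then adding to the last column all the first [q]
    columns and the combination [u] of the middle ones clears it
    down to [x0]. *)
Lemma det_bordered (q m : nat) (D : 'M[R]_m) (a : 'rV[R]_m) (u : 'cV[R]_m)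
    (b : 'rV[R]_q) (b0 X x0 : R) :
  D *m u = b0 *: u + u *m b *m const_mx 1 -> a *m u = (X - x0)%:M ->
  \det (block_mx X%:M (row_mx (- (const_mx 1 *m a)) 0)
                 (col_mx (- (u *m b)) 0)
                 (block_mx D (- (b0 *: u)) (- a) X%:M)) =
  X ^+ q * \det D * x0.
Proof.
move=> Du au; set M := block_mx _ _ _ _.
pose L : 'M[R]_(q + (m + 1)) := block_mx 1%:M (row_mx 0 (- const_mx 1)) 0 1%:M.
pose U : 'M[R]_(q + (m + 1)) :=
  block_mx 1%:M (row_mx 0 (const_mx 1)) 0 (block_mx 1%:M u 0 1%:M).
have detL : \det L = 1 by rewrite det_ublock !det1 mulr1.
have detU : \det U = 1 by rewrite det_ublock det1 det_ublock !det1 !mulr1.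
have E : L *m M *m U = block_mx X%:M 0 (col_mx (- (u *m b)) 0)
                                (block_mx D 0 (- a) x0%:M).
  rewrite mulmx_block !mul1mx !mul0mx !add0r mul_row_col mul0mx mulmx0 !addr0.
  rewrite mul_row_block !mul0mx !add0r mulmxN mulNmx opprK.
  rewrite add_row_mx addNr add0r mulNmx mul_mx_scalar.
  rewrite mulmx_block !mulmx1 !mulmx0 !addr0.
  rewrite mul_mx_row mulmx0 mul_scalar_mx mul_row_block.
  rewrite !mul0mx !mulmx0 !mulmx1 !add0r add_row_mx addr0 addrN row_mx0.
  rewrite mul_col_row !mul0mx !mulmx0 mulNmx mulmx_block !mulmx1 !mulmx0 !addr0.
  rewrite Du mulNmx au add_block_mx !add0r.
  congr (block_mx _ _ _ _); congr (block_mx _ _ _ _).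
    by rewrite [b0 *: u + _]addrC addrK addNr.
  by rewrite -raddfN -raddfD /= opprB subrK.
have := congr1 (@determinant _ _) E.
rewrite !det_mulmx detL detU mul1r mulr1 => ->.
by rewrite det_lblock det_lblock !det_scalar expr1 mulrA.
Qed.

End CompleteBipartiteDeterminant.

(** * The degree enumerator of a complete bipartite graph *)

Section CompleteBipartite.

Lemma adj_Kmn_ll m n i i' : adj (Kmn m n) (inl i) (inl i') = false.
Proof.
apply/negP => /imset2P[a b _ _] E.
by have := set22 (inl a) (inr b); rewrite -E !inE.
Qed.

Lemma adj_Kmn_rr m n j j' : adj (Kmn m n) (inr j) (inr j') = false.
Proof.
apply/negP => /imset2P[a b _ _] E.
by have := set21 (inl a) (inr b); rewrite -E !inE.
Qed.

Lemma adj_Kmn_lr m n i j : adj (Kmn m n) (inl i) (inr j).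
Proof. by apply/imset2P; exists i j. Qed.

Lemma adj_Kmn_rl m n i j : adj (Kmn m n) (inr j) (inl i).
Proof. by rewrite adj_sym adj_Kmn_lr. Qed.

Variables p q : nat.
Let V : finType := ('I_p.+1 + 'I_q.+1)%type.

(** In this order of the vertices the reduced Laplacian has the block form of
    [det_bordered]. *)
Definition elim_vertex (k : 'I_(q + (p.+1 + 1))) : V :=
  match split k with
  | inl j => inr (lift ord0 j)
  | inr k' => match split k' with inl i => inl i | inr _ => inr ord0 end
  end.

Definition elim_index (v : V) : 'I_(q + (p.+1 + 1)) :=
  match v with
  | inl i => rshift q (lshift 1 i)
  | inr j => if unlift ord0 j is Some j' then lshift _ j'
             else rshift q (rshift p.+1 ord0)
  end.

Lemma elim_vertex_other j : elim_vertex (lshift _ j) = inr (lift ord0 j).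
Proof. by rewrite /elim_vertex (unsplitK (inl _)). Qed.

Lemma elim_vertex_left i : elim_vertex (rshift q (lshift 1 i)) = inl i.
Proof. by rewrite /elim_vertex (unsplitK (inr _)) (unsplitK (inl _)). Qed.

Lemma elim_vertex_last k : elim_vertex (rshift q (rshift p.+1 k)) = inr ord0.
Proof. by rewrite /elim_vertex (unsplitK (inr _)) (unsplitK (inr _)). Qed.

Lemma elim_vertexK : cancel elim_vertex elim_index.
Proof.
move=> k; rewrite -[k]splitK; case: (split k) => [j|k'] /=.
  by rewrite elim_vertex_other /elim_index liftK.
rewrite -[k']splitK; case: (split k') => [i|k''] /=.
  by rewrite elim_vertex_left.
by rewrite elim_vertex_last /elim_index unlift_none (ord1 k'').
Qed.

Lemma elim_indexK : cancel elim_index elim_vertex.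
Proof.
case=> [i|j] /=; first exact: elim_vertex_left.
by case: unliftP => [j' ->|->]; rewrite ?elim_vertex_other ?elim_vertex_last.
Qed.

Variables (R : fieldType) (x : 'I_p.+1 -> R) (y : 'I_q.+1 -> R).

Let z (v : V) : R := match v with inl i => x i | inr j => y j end.

(** With the root on the left side, its row is a unit vector; this is why the
    first diagonal entry of the middle block is 1 and the corresponding entry
    of [u] is 0. *)
Lemma det_reduced_laplacian_Kmn :
  \det (\matrix_(i, j) reduced_laplacian (inl ord0) (Kmn p.+1 q.+1) z
          (elim_vertex i) (elim_vertex j)) =
  (\sum_i x i) ^+ q * (\sum_j y j) ^+ p * x ord0.
Proof.
set X := \sum_i x i; set Y := \sum_j y j.
pose L := reduced_laplacian (inl ord0) (Kmn p.+1 q.+1) z.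
have sumV (F : V -> R) : \sum_v F v = \sum_i F (inl i) + \sum_j F (inr j).
  exact: big_sumType.
have Lrr j j' : L (inr j) (inr j') = (j == j')%:R * X.
  rewrite /L /reduced_laplacian /= sumV !adj_Kmn_rr mul0r subr0; congr (_ * _).
  rewrite [X in _ + X]big1 ?addr0 => [|k _]; last by rewrite adj_Kmn_rr mul0r.
  by apply: eq_bigr => k _; rewrite adj_Kmn_rl mul1r.
have Lrl j i : L (inr j) (inl i) = - x i.
  by rewrite /L /reduced_laplacian /= mul0r sub0r adj_Kmn_rl mul1r.
have Llr i j : L (inl i) (inr j) = - ((i != ord0)%:R * y j).
  rewrite /L /reduced_laplacian (_ : (inl i == inl ord0 :> V) = (i == ord0)) //.
  case: eqP => _ /=; first by rewrite mul0r oppr0.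
  by rewrite mul0r sub0r adj_Kmn_lr.
have Lll i i' : L (inl i) (inl i') =
    (if i == ord0 then 1 else Y) *+ (i == i').
  rewrite /L /reduced_laplacian (_ : (inl i == inl ord0 :> V) = (i == ord0)) //.
  have [->|_] := eqVneq i ord0; first by rewrite eq_sym.
  rewrite sumV adj_Kmn_ll mul0r subr0 mulr_natl; congr (_ *+ _).
  rewrite big1 ?add0r => [|k _]; last by rewrite adj_Kmn_ll mul0r.
  by apply: eq_bigr => k _; rewrite adj_Kmn_lr mul1r.
pose d : 'rV[R]_p.+1 := \row_i (if i == ord0 then 1 else Y).
pose u : 'cV[R]_p.+1 := \col_i (i != ord0)%:R.
have detD : \det (diag_mx d) = Y ^+ p.
  rewrite det_diag big_ord_recl !mxE eqxx mul1r.
  under eq_bigr do rewrite !mxE /=.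
  by rewrite prodr_const card_ord.
rewrite -detD.
rewrite -(@det_bordered R q p.+1 (diag_mx d) (\row_i x i) u
   (\row_j y (lift ord0 j)) (y ord0)); last first.
- apply/matrixP => i j; rewrite !ord1 !mxE eqxx mulr1n.
  rewrite /X !big_ord_recl addrAC subrr add0r.
  rewrite !mxE /= mulr0 add0r; apply: eq_bigr => k _.
  by rewrite !mxE /= mulr1.
- apply/matrixP => i j; rewrite !ord1 mul_diag_mx !mxE.
  under eq_bigr do rewrite !mxE big_ord1 !mxE mulr1.
  rewrite -mulr_sumr [X in X + _]mulrC -mulrDr.
  have [_|_] := eqVneq i ord0; first by rewrite mulr0 mul0r.
  by rewrite mulr1 mul1r /Y big_ord_recl.
congr (\det _); rewrite -[LHS]submxK.
congr block_mx.
- apply/matrixP => j j'; rewrite !mxE !elim_vertex_other -/L Lrr mulr_natl.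
  by rewrite (inj_eq lift_inj).
- rewrite -[LHS]hsubmxK; congr row_mx; apply/matrixP => j i.
    rewrite !mxE elim_vertex_other elim_vertex_left -/L Lrl.
    by rewrite big_ord1 !mxE mul1r.
  by rewrite !mxE elim_vertex_other elim_vertex_last -/L Lrr mul0r.
- rewrite -[LHS]vsubmxK; congr col_mx; apply/matrixP => i j.
    rewrite !mxE elim_vertex_other elim_vertex_left -/L Llr.
    by rewrite big_ord1 !mxE.
  by rewrite !mxE elim_vertex_other elim_vertex_last -/L Lrr mul0r.
- rewrite -[LHS]submxK; congr block_mx; apply/matrixP => i j; rewrite !mxE.
  + by rewrite !elim_vertex_left -/L Lll.
  + by rewrite elim_vertex_left elim_vertex_last -/L Llr mulrC.
  + by rewrite elim_vertex_left elim_vertex_last -/L Lrl.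
  by rewrite !elim_vertex_last -/L Lrr eqxx mul1r (ord1 i) (ord1 j).
Qed.

(** The factor [x ord0] of the determinant is the weight of the root, which
    completes the product over the other vertices. *)
Theorem degree_enumerator_Kmn :
  \sum_(T | `[< is_tree T >] && (edges T \subset edges (Kmn p.+1 q.+1)))
     \prod_v z v ^+ degree T v =
  (\prod_v z v) * ((\sum_i x i) ^+ q * (\sum_j y j) ^+ p).
Proof.
rewrite (weighted_matrix_tree (inl ord0) elim_vertexK elim_indexK).
rewrite det_reduced_laplacian_Kmn mulrCA [RHS]mulrC; congr (_ * _).
by rewrite [RHS](bigD1 (inl ord0)) //= mulrC.
Qed.

End CompleteBipartite.

(** * Multinomial coefficients and roots of unity *)

Section Multinomial.

Definition fiber_size (l m : nat) (f : 'I_m -> 'I_l) (p : 'I_l) : nat :=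
  (\sum_i (f i == p))%N.

Lemma sum_fiber_size (l m : nat) (f : 'I_m -> 'I_l) :
  (\sum_p fiber_size f p)%N = m.
Proof.
rewrite exchange_big /= -[RHS]card_ord -sum1_card; apply: eq_bigr => i _.
by rewrite (bigD1 (f i)) //= eqxx big1 // => p; rewrite eq_sym => /negPf->.
Qed.

Definition ffun_cons (A : Type) (m : nat) (a : A) (f : {ffun 'I_m -> A}) :
    {ffun 'I_m.+1 -> A} :=
  [ffun i => oapp f a (unlift ord0 i)].

Lemma ffun_cons_bij (A : Type) (m : nat) :
  bijective (fun u : A * {ffun 'I_m -> A} => ffun_cons u.1 u.2).
Proof.
exists (fun h : {ffun 'I_m.+1 -> A} => (h ord0, [ffun j => h (lift ord0 j)])).
  case=> a f; rewrite /ffun_cons /= ffunE unlift_none; congr pair.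
  by apply/ffunP => j; rewrite !ffunE liftK.
move=> h; apply/ffunP => i; rewrite !ffunE /=.
by case: unliftP => [j ->|->] //=; rewrite ffunE.
Qed.

Lemma fiber_size_cons (l m : nat) (a : 'I_l) (f : {ffun 'I_m -> 'I_l}) p :
  fiber_size (ffun_cons a f) p = ((a == p) + fiber_size f p)%N.
Proof.
rewrite /fiber_size big_ord_recl ffunE unlift_none; congr (_ + _)%N.
by apply: eq_bigr => j _; rewrite ffunE liftK.
Qed.

(** Condition on the value [a] at the first point: what remains is a function on
    one point less whose fibre over [a] is smaller by one. After
    multiplying by the factorials, each [a] contributes [k a] times the factorial
    of [m], and the [k a] add up to [m.+1]. *)
Lemma multinomial_count (l m : nat) (k : 'I_l -> nat) :
  (\sum_p k p)%N = m ->
  (#|[set f : {ffun 'I_m -> 'I_l} | [forall p, fiber_size f p == k p]]| *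
   \prod_p (k p)`!)%N = m`!.
Proof.
elim: m k => [|m IH] k km.
  have k0 p : k p = 0%N.
    by apply/eqP; move/eqP: km; rewrite sum_nat_eq0 => /forallP/(_ p).
  rewrite big1 ?muln1 => [|p _]; last by rewrite k0.
  rewrite (eq_card (B := predT)) ?card_ffun ?card_ord ?expn0 // => f.
  by rewrite !inE; apply/forallP => p; rewrite k0 /fiber_size big_ord0.
set S := [set f | _].
have -> : #|S| =
    (\sum_a \sum_(f : {ffun 'I_m -> 'I_l} | ffun_cons a f \in S) 1)%N.
  rewrite pair_big_dep -sum1_card.
  by rewrite (reindex _ (onW_bij _ (ffun_cons_bij 'I_l m))).
rewrite big_distrl /= factS -[X in (X * m`!)%N]km big_distrl /=.
apply: eq_bigr => a _.
rewrite sum1dep_card; case ka: (k a) => [|j].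
  rewrite mul0n (eq_card0 _) ?mul0n // => f; rewrite !inE.
  by apply/forallP => /(_ a); rewrite fiber_size_cons eqxx ka.
pose k' p := (k p - (a == p))%N.
have k'E p : k p = ((a == p) + k' p)%N.
  by rewrite /k' subnKC //; case: eqP => // <-; rewrite ka.
have k'm : (\sum_p k' p)%N = m.
  have: (\sum_p k p = 1 + \sum_p k' p)%N.
    rewrite (eq_bigr _ (fun p _ => k'E p)) big_split /=; congr (_ + _)%N.
    by rewrite (bigD1 a) //= eqxx big1 // => p; rewrite eq_sym => /negPf->.
  by rewrite km => -[].
have k'a : k' a = j by rewrite /k' ka eqxx subn1.
rewrite -(IH _ k'm) (bigD1 a) //= [in RHS](bigD1 a) //= ka k'a factS.
rewrite mulnCA -!mulnA; congr (_ * _)%N; rewrite mulnCA; congr (_ * (_ * _))%N.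
  apply: eq_card => f; rewrite !inE; apply: eq_forallb => p.
  by rewrite fiber_size_cons k'E eqn_add2l.
by apply: eq_bigr => p; rewrite eq_sym => /negPf ap; rewrite /k' ap subn0.
Qed.

(** The summand on the left depends only on the fibre sizes of the colouring. *)
Lemma sum_colourings (R : numFieldType) (l m e : nat) (w : 'I_l -> R) :
  \sum_(f : {ffun 'I_m -> 'I_l}) (\sum_i w (f i)) ^+ e =
  \sum_(k in weak_compositions l m)
    ((m`!)%:R / \prod_(p < l) ((k p)`!)%:R) *
    (\sum_(p < l) (k p)%:R * w p) ^+ e.
Proof.
pose phi (f : {ffun 'I_m -> 'I_l}) : {ffun 'I_l -> 'I_m.+1} :=
  [ffun p => inord (fiber_size f p)].
have phiE f p : phi f p = fiber_size f p :> nat.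
  rewrite ffunE inordK // ltnS -[leqRHS](sum_fiber_size f).
  by rewrite (bigD1 p) //= leq_addr.
rewrite (partition_big phi [in weak_compositions l m]) => [|f _]; last first.
  by rewrite inE; under eq_bigr do rewrite phiE; rewrite sum_fiber_size.
apply: eq_bigr => k; rewrite inE => /eqP km.
rewrite (eq_bigr (fun=> (\sum_(p < l) (k p)%:R * w p) ^+ e)); last first.
  move=> f /andP[_ /eqP <-]; congr (_ ^+ _).
  under [RHS]eq_bigr do rewrite phiE natr_sum mulr_suml.
  rewrite exchange_big; apply: eq_bigr => i _ /=.
  rewrite (bigD1 (f i)) //= eqxx mul1r big1 ?addr0 // => p.
  by rewrite eq_sym => /negPf->; rewrite mul0r.
rewrite (eq_bigl [in [set f : {ffun 'I_m -> 'I_l} |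
                        [forall p, fiber_size f p == k p]]]).
  rewrite sumr_const -[LHS]mulr_natl; congr (_ * _).
  rewrite -(multinomial_count km) natrM natr_prod mulfK //.
  by apply/prodf_neq0 => p _; rewrite pnatr_eq0 -lt0n fact_gt0.
move=> f; rewrite inE /=; apply/eqP/forallP => [<- p|E]; first by rewrite phiE.
by apply/ffunP => p; apply/val_inj; rewrite /= phiE; apply/eqP/E.
Qed.

End Multinomial.

Section RootsOfUnityFilter.

Lemma sum_primitive_root (R : fieldType) (l d : nat) (w : R) :
  l.-primitive_root w ->
  \sum_(p < l) (w ^+ p) ^+ d = (if (l %| d)%N then l%:R else 0).
Proof.
move=> prim; under eq_bigr do rewrite exprAC.
case: ifPn => [|ld].
  rewrite (prim_order_dvd prim) => /eqP wd.
  by under eq_bigr do rewrite wd expr1n; rewrite sumr_const card_ord.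
have wd : w ^+ d - 1 != 0 by rewrite subr_eq0 -(prim_order_dvd prim).
apply: (mulfI wd); rewrite -subrX1 mulr0 exprAC.
by rewrite (prim_expr_order prim) expr1n subrr.
Qed.

(** Adding [l.-1] stands for subtracting 1, without truncation at 0. *)
Lemma dvdn_congruent_1 (l d : nat) : (0 < l)%N ->
  (l %| d + l.-1)%N = (d == 1 %[mod l])%N.
Proof.
move=> l_gt0; rewrite -(eqn_modDr l.-1) add1n prednK // modnn.
by [].
Qed.

End RootsOfUnityFilter.

(** * The complex roots of unity *)

Section ComplexRootOfUnity.

Variable R : realType.

Lemma cis_exp (t : R) (n : nat) :
  (cos t +i* sin t) ^+ n = cos (t *+ n) +i* sin (t *+ n).
Proof.
elim: n => [|n IH]; first by rewrite expr0 mulr0n cos0 sin0.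
rewrite exprS IH mulrS cosD sinD; apply/eqP.
by rewrite eq_complex /= eqxx /= addrC eqxx.
Qed.

(** By the double angle formula, a cosine equal to 1 at [t] forces a vanishing
    sine at [t / 2]. *)
Lemma cis_eq1 (t : R) : 0 < t < pi *+ 2 -> cos t +i* sin t != 1.
Proof.
case/andP=> t0 t2; rewrite eq_complex negb_and /=; apply/orP; left.
have tE : t = (t / 2) *+ 2 by rewrite -mulr_natr mulfVK // pnatr_eq0.
have s0 : 0 < sin (t / 2).
  by apply: sin_gt0_pi; rewrite divr_gt0 //= ltr_pdivrMr // mulr_natr.
rewrite tE cos_mulr2n cos2sin2; apply/eqP => E.
have /eqP : sin (t / 2) ^+ 2 *+ 2 = 0.
  by move: E; set a := sin _ ^+ 2; lra.
by rewrite mulrn_eq0 expf_eq0 /= gt_eqF.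
Qed.

Lemma cexp_root (l p : nat) :
  cexp ((2%:R * pi) *i / l%:R * p%:R) =
  cos (pi *+ 2 / l%:R *+ p) +i* sin (pi *+ 2 / l%:R *+ p) :> R[i].
Proof.
have -> : (2%:R * pi) *i / l%:R * p%:R = (pi *+ 2 / l%:R *+ p) *i :> R[i].
  rewrite -(rmorph_nat (real_complex R)) -(rmorph_nat (real_complex R) p).
  rewrite -fmorphV; apply/eqP; rewrite eq_complex /=.
  by rewrite !(mul0r, mulr0, subr0, addr0, add0r, oppr0, mul0rn)
    mulr_natl !mulr_natr ?oppr0 ?mul0rn !eqxx.
by rewrite /cexp /= expR0 mul1r.
Qed.

(** The factor [1%:R] on the right keeps the angle in the form [cexp_root]
    treats. *)
Lemma cexp_exp (l p : nat) :
  cexp ((2%:R * pi) *i / l%:R * p%:R) =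
  cexp ((2%:R * pi) *i / l%:R * 1%:R) ^+ p :> R[i].
Proof. by rewrite !cexp_root cis_exp mulr1n. Qed.

Lemma cexp_primitive (l : nat) : (0 < l)%N ->
  l.-primitive_root (cexp ((2%:R * pi) *i / l%:R * 1%:R) : R[i]).
Proof.
move=> l_gt0; rewrite /primitive_root_of_unity l_gt0; apply/forallP => i.
have l0 : 0 < l%:R :> R by rewrite ltr0n.
rewrite unity_rootE -cexp_exp cexp_root; apply/eqP.
have [->|il] := eqVneq i.+1 l.
  rewrite -[_ / _ *+ _]mulr_natr divfK ?lt0r_neq0 // cos2pi sin2pi; exact: eqxx.
apply/negbTE/cis_eq1.
have pi0 : 0 < pi *+ 2 :> R by rewrite mulrn_wgt0 // pi_gt0.
rewrite -[_ / _ *+ _]mulr_natr mulrAC divr_gt0 ?mulr_gt0 ?ltr0n //=.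
by rewrite ltr_pdivrMr // ltr_pM2l // ltr_nat ltn_neqAle il ltn_ord.
Qed.

End ComplexRootOfUnity.

(** * Counting congruent trees *)

Section Counting.

(** The common residue is that of a leaf. *)
Lemma congruent_tree_degree (l : nat) (V : finType) (T : sgraph V) (r : V) :
  is_tree T -> (1 < #|V|)%N ->
  (forall u v : V, degree T u = degree T v %[mod l]) <->
  (forall v : V, degree T v = 1 %[mod l]).
Proof.
move=> tT V2; split=> [E v|E u v]; last by rewrite !E.
by have [u <-] := tree_leaf r tT V2.
Qed.

(** The sum of products factors over the points of [I], and each factor is a
    power sum of the [l]-th roots of unity, with exponent [d i - 1]
    modulo [l]. *)
Lemma sum_degree_filter (F : fieldType) (l : nat) (w : F) (I : finType)
    (d : I -> nat) : l.-primitive_root w ->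
  \sum_(f : {ffun I -> 'I_l}) \prod_i (w ^+ f i) ^+ (d i + l.-1) =
  \prod_i ((d i == 1 %[mod l])%N%:R * l%:R).
Proof.
move=> prim.
rewrite -(bigA_distr_bigA (fun i (p : 'I_l) => (w ^+ p) ^+ (d i + l.-1))).
apply: eq_bigr => i _; rewrite (sum_primitive_root _ prim).
rewrite dvdn_congruent_1 ?(prim_order_gt0 prim) //.
by case: ifP; rewrite ?mul1r ?mul0r.
Qed.

Theorem tau_Kmn_root_of_unity (F : numFieldType) (p q l : nat) (w : F) :
  l.-primitive_root w ->
  (tau l (Kmn p.+1 q.+1))%:R * l%:R ^+ (p.+1 + q.+1) =
  (\sum_(f : {ffun 'I_p.+1 -> 'I_l}) (\sum_i w ^+ f i) ^+ q) *
  (\sum_(g : {ffun 'I_q.+1 -> 'I_l}) (\sum_j w ^+ g j) ^+ p).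
Proof.
move=> prim; have l_gt0 := prim_order_gt0 prim.
pose V : finType := ('I_p.+1 + 'I_q.+1)%type.
pose P (T : sgraph V) :=
  `[< is_tree T >] && (edges T \subset edges (Kmn p.+1 q.+1)).
pose D (T : sgraph V) v := (degree T v + l.-1)%N.
transitivity (\sum_(T | P T)
   \sum_(f : {ffun 'I_p.+1 -> 'I_l}) \sum_(g : {ffun 'I_q.+1 -> 'I_l})
     (\prod_i (w ^+ f i) ^+ D T (inl i)) * \prod_j (w ^+ g j) ^+ D T (inr j)).
  rewrite /tau -sum1_card natr_sum mulr_suml big_mkcond [RHS]big_mkcond.
  apply: eq_bigr => T _; rewrite inE.
  have -> : `[< is_congruent_spanning_tree l (Kmn p.+1 q.+1) T >] =
      P T && [forall v, degree T v == 1 %[mod l]]%N.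
    have V2 : (1 < #|V|)%N by rewrite card_sum !card_ord addSn addnS.
    apply/asboolP/andP => [[sT [tT _]]|].
      move=> /(congruent_tree_degree _ (inl ord0) tT V2) E.
      by split; [rewrite /P sT andbT; apply/asboolP |
                  apply/forallP => v; apply/eqP].
    case=> /andP[/asboolP tT sT] /forallP E; split=> //; split=> //.
    by apply/(congruent_tree_degree _ (inl ord0) tT V2) => v; apply/eqP.
  case: (P T) => //=.
  under eq_bigr do rewrite -mulr_sumr.
  rewrite -mulr_suml (sum_degree_filter (fun i => degree T (inl i)) prim).
  rewrite (sum_degree_filter (fun j => degree T (inr j)) prim).
  rewrite !big_split /= !prodr_const !card_ord.
  rewrite mulrACA -exprD; case: ifPn => [/forallP E|/forallPn[v nE]].
    by rewrite !big1 ?mulr1 // => v _; rewrite E.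
  suff -> : \prod_i (degree T (inl i) == 1 %[mod l])%N%:R *
            \prod_j (degree T (inr j) == 1 %[mod l])%N%:R = 0 :> F.
    by rewrite mul0r.
  by apply/eqP; case: v nE => i /negPf nE; rewrite mulf_eq0; apply/orP;
    [left|right]; apply/prodf_eq0; exists i; rewrite // nE.
rewrite exchange_big mulr_suml; apply: eq_bigr => f _.
rewrite exchange_big mulr_sumr; apply: eq_bigr => g _.
(* The roots of unity raised to l - 1 cancel the vertex weights in the degree
   enumerator, for their l-th powers are 1. *)
have wl k : (w ^+ k) ^+ l.-1 * w ^+ k = 1.
  by rewrite -exprSr prednK // exprAC (prim_expr_order prim) expr1n.
have prod_wl k (h : 'I_k -> 'I_l) :
    \prod_i (w ^+ h i) ^+ l.-1 * \prod_i w ^+ h i = 1.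
  by rewrite -big_split big1 // => i _; exact: wl.
have E := degree_enumerator_Kmn (fun i => w ^+ f i) (fun j => w ^+ g j).
rewrite big_sumType /= in E.
have -> : (\sum_i w ^+ f i) ^+ q * (\sum_j w ^+ g j) ^+ p =
   (\prod_i (w ^+ f i) ^+ l.-1 * \prod_j (w ^+ g j) ^+ l.-1) *
   ((\prod_i w ^+ f i * \prod_j w ^+ g j) *
    ((\sum_i w ^+ f i) ^+ q * (\sum_j w ^+ g j) ^+ p)).
  by rewrite [RHS]mulrA [X in _ = X * _]mulrACA !prod_wl !mul1r.
rewrite -E mulr_sumr; apply: eq_bigr => T _.
rewrite big_sumType /= mulrACA -!big_split; congr (_ * _);
  by apply: eq_bigr => k _; rewrite exprD mulrC.
Qed.

End Counting.

Theorem theorem1p12 (R : realType) (m n l : nat)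
    (m_gt0 : (0 < m)%N) (n_gt0 : (0 < n)%N) (l_gt0 : (0 < l)%N) :
  (tau l (Kmn m n))%:R =
    1 / l%:R ^+ (m + n) *
    (\sum_(k in weak_compositions l m)
       ((m`!)%:R / \prod_(p < l) ((k p)`!)%:R) *
       (\sum_(p < l) (k p)%:R *
          cexp ((2%:R * pi) *i / l%:R * p%:R)) ^+ (n - 1)) *
    (\sum_(s in weak_compositions l n)
       ((n`!)%:R / \prod_(q < l) ((s q)`!)%:R) *
       (\sum_(q < l) (s q)%:R *
          cexp ((2%:R * pi) *i / l%:R * q%:R)) ^+ (m - 1))
  :> R[i].
Proof.
rewrite -!sum_colourings -mulrA.
have l0 : l%:R ^+ (m + n) != 0 :> R[i] by rewrite expf_neq0 // pnatr_eq0 -lt0n.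
rewrite div1r; apply: (canRL (mulKf l0)).
case: m n m_gt0 n_gt0 l0 => [|p] [|q] // _ _ _.
rewrite mulrC (tau_Kmn_root_of_unity _ _ (cexp_primitive R l_gt0)) !subn1.
by congr (_ * _); apply: eq_bigr => f _; congr (_ ^+ _); apply: eq_bigr => i _;
  rewrite [RHS]cexp_exp.
Qed.
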